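(* Let $\omega=\omega(n)$ be any function with $\omega\le n$ and $\omega\to\infty$ as $n\to\infty$, and let $p=\omega/n$. Then asymptotically almost surely $$\chi_{\text{lin}}(\mathcal{G}(n,p)) \ge n-\frac{510\,n}{\sqrt{\omega}}.$$
   Context: $\mathcal{G}(n,p)$ is the binomial random graph on vertex set $[n]=\{1,\dots,n\}$ in which each of the $\binom n2$ pairs is an edge independently with probability $p$. An event holds asymptotically almost surely (a.a.s.) if its probability tends to $1$ as $n\to\infty$. Given a vertex colouring $\phi$ of a graph $G$ and a set $S$ of vertices, a vertex $v\in S$ is a centre of $S$ if $\phi(v)\ne\phi(w)$ for all $w\in S$, $w\neq v$. A linear $k$-colouring of $G$ is a map $\phi:V(G)\to\{1,\dots,k\}$ such that the vertex set of every subgraph of $G$ that is a path has a centre. The linear chromatic number $\chi_{\text{lin}}(G)$ is the least $k$ for which a linear $k$-colouring of $G$ exists. *)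

(* Defs.v *)
From mathcomp Require Import all_boot all_order all_algebra.
From mathcomp Require Import all_classical all_reals all_analysis.
Set Implicit Arguments.
Unset Strict Implicit.
Unset Printing Implicit Defensive.
Import Order.TTheory GRing.Theory Num.Theory.

Section LinearColouring.
Variables (T : finType) (e : rel T).

Definition path_vertex_set (S : {set T}) : Prop :=
  exists (x : T) (s : seq T),
    [/\ path e x s, uniq (x :: s) & S = [set v in x :: s]].

Definition centre (C : Type) (phi : T -> C) (S : {set T}) (v : T) : Prop :=
  v \in S /\ forall w, w \in S -> w != v -> phi v <> phi w.

Definition linear_colouring (k : nat) (phi : T -> 'I_k) : Prop :=
  forall S, path_vertex_set S -> exists v, centre phi S v.

Definition linearly_colourable (k : nat) : Prop :=
  exists phi : T -> 'I_k, linear_colouring phi.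

Lemma linearly_colourable_card : linearly_colourable #|T|.
Proof.
exists (@enum_rank T) => _ [x [s [_ _ ->]]]; exists x.
by split=> [|w _ /eqP wx /enum_rank_inj xw]; [rewrite inE mem_head | apply: wx].
Qed.

Lemma ex_linearly_colourable : exists k, `[< linearly_colourable k >].
Proof. by exists #|T|; apply/asboolP; exact: linearly_colourable_card. Qed.

Definition chi_lin : nat := ex_minn ex_linearly_colourable.

End LinearColouring.

(* A simple graph on a finite vertex type is given by its edge set, a set of
   two-element sets of vertices. *)
Definition vertex_pairs (T : finType) : {set {set T}} :=
  [set f : {set T} | #|f| == 2]%SET.

Definition adjacent (T : finType) (E : {set {set T}}) : rel T :=
  [rel x y | (x != y) && ([set x; y]%SET \in E)].

(* The law of G(n, p): an edge set E has weight p^|E| (1 - p)^(C(n,2) - |E|).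
   It is a probability when 0 <= p <= 1. *)
Definition gnp_prob (R : realType) (n : nat) (p : R)
    (A : pred (rel 'I_n)) : R :=
  (\sum_(E in powerset (vertex_pairs 'I_n) | A (adjacent E))
    \prod_(f in vertex_pairs 'I_n) (if f \in E then p else 1 - p))%R.

(* Main.v *)
(* Two vertex sets of order n / sqrt omega are typically joined by an edge.  If
   few colours are used, the vertices whose colour is repeated form a set of
   order n / sqrt omega; deleting badly expanding sets, together with the
   vertices left alone in their colour, gives a set S in which no colour occurs
   exactly once and on which the graph expands.  A Hamiltonian path of S is then
   a path without a centre.

   For the Hamiltonian path, split G(n, p) into two independent rounds.  Edges
   between large sets and expansion come from the first round.  By Posa
   rotations, if an expander on S is not traceable then of order n^2 / omega
   pairs ("boosters") lengthen its longest paths, so the second round misses all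
   of them with probability exp(-c n) for a large c.  This beats the union bound
   over S and over the set Gamma of second-round edges already used, since
   |Gamma| <= |S| = O(n / sqrt omega) costs only a factor
   omega^O(n / sqrt omega) = exp(o(n)). *)

Require Import Defs.
From mathcomp Require Import all_boot all_order all_algebra.
From mathcomp Require Import all_classical all_reals all_analysis.
From mathcomp Require Import zify ring lra.
Set Implicit Arguments.
Unset Strict Implicit.
Unset Printing Implicit Defensive.
Import Order.TTheory GRing.Theory Num.Theory.
Import numFieldNormedType.Exports.

(** * Posa rotations of longest paths *)

Section Rotation.
Local Open Scope nat_scope.
Variables (T : finType) (e : rel T) (S : {set T}).

Definition path_within (Q : seq T) := [&& uniq Q, sorted e Q & all (mem S) Q].

Definition longest (Q : seq T) :=
  path_within Q /\ forall Q', path_within Q' -> size Q' <= size Q.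

Definition nbh (A : {set T}) : {set T} :=
  [set y in S :\: A | [exists x in A, e x y]].

Definition expander (m : nat) :=
  forall A : {set T}, A \subset S -> 0 < #|A| <= m -> 2 * #|A| < #|nbh A|.

Definition linked :=
  forall A : {set T}, A \proper S -> A != finset.set0 ->
    exists x y, [/\ x \in A, y \in S :\: A & e x y].

Inductive rotation (P : seq T) : seq T -> Prop :=
| Rotation0 : rotation P P
| RotationS Q1 w Q2 : rotation P (Q1 ++ w :: Q2) -> e w (last w Q2) ->
    rotation P (Q1 ++ w :: rev Q2).

Lemma path_rev_tail (r : rel T) w Q :
  symmetric r -> r w (last w Q) -> path r w Q -> path r w (rev Q).
Proof.
move=> rs; case/lastP: Q => // Q z; rewrite last_rcons rev_rcons /= => -> pQ.
have : path r z (rcons (rev Q) w).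
  rewrite -rev_cons -[z in path r z](last_rcons w Q) -(belast_rcons w Q z) rev_path.
  by rewrite (eq_path (e' := r)) // => a b; rewrite /= rs.
by rewrite rcons_path => /andP[].
Qed.

Lemma sorted_rev_tail (r : rel T) Q1 w Q2 :
  symmetric r -> r w (last w Q2) -> sorted r (Q1 ++ w :: Q2) ->
  sorted r (Q1 ++ w :: rev Q2).
Proof.
move=> rs rw; case: Q1 => [|x Q1] /=; first exact: path_rev_tail.
by rewrite !cat_path /= => /and3P[-> -> pQ]; rewrite path_rev_tail.
Qed.

Hypothesis e_sym : symmetric e.

Lemma rotation_perm P Q : rotation P Q -> perm_eq Q P.
Proof.
elim=> // Q1 w Q2 _ IH _; apply: perm_trans IH.
by rewrite perm_cat2l perm_cons perm_rev.
Qed.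

Lemma rotation_within P Q : rotation P Q -> path_within P -> path_within Q.
Proof.
move=> PQ /and3P[uP sP aP]; have pQ := rotation_perm PQ.
apply/and3P; split; [by rewrite (perm_uniq pQ) | | by rewrite (perm_all _ pQ)].
by elim: PQ {pQ} => // Q1 w Q2 _ sQ ew; apply: sorted_rev_tail.
Qed.

Lemma rotation_head x P Q : rotation P Q -> head x Q = head x P.
Proof. by elim=> // Q1 w Q2 _ <- _; case: Q1. Qed.

Lemma longest_perm P Q : longest P -> path_within Q -> perm_eq Q P -> longest Q.
Proof. by move=> [_ mP] wQ /perm_size sQ; split=> // Q' /mP; rewrite sQ. Qed.

Section Posa.
Variables (x : T) (s : seq T).
Let P := x :: s.
Hypothesis longP : longest P.

Definition rotation_ends : {set T} :=
  [set y | `[< exists2 Q, rotation P Q & last x Q = y >]].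
Let R := rotation_ends.

Let adjP : rel T := [rel a b |
  (index b P == (index a P).+1) || (index a P == (index b P).+1)].

(* A vertex with neither itself nor a neighbour on P in R keeps its two path
   edges under every rotation. *)
Let safe u := (u \notin R) && [forall r in R, ~~ adjP u r].
Let stable : rel T := [rel a b | safe a || safe b ==> adjP a b].

(** A rotation at [w] replaces the consecutive pair [w], [v] by [w] and the old end. The old end
    lies in [R], so it is not safe. Were [w] safe, stability of the pair [w], [v] would make the new
    end [v] a neighbour of [w] on [P] lying in [R]. *)
Lemma rotation_stable Q : rotation P Q -> sorted stable Q.
Proof.
have stC : symmetric stable by move=> a b; congr (_ ==> _); apply: orbC.
have uP : uniq P by case: longP => /andP[].
elim=> [|Q1 w [|v Q2] // rot IH ew].
  apply/(sortedP x) => i ilt; apply/implyP=> _; apply/orP; left.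
  by rewrite !index_uniq // ltnW.
apply: sorted_rev_tail => //.
have wR : last w (v :: Q2) \in R.
  by rewrite inE; apply/asboolP; exists (Q1 ++ w :: v :: Q2); rewrite // last_cat.
have vR : v \in R.
  rewrite inE; apply/asboolP; exists (Q1 ++ w :: rev (v :: Q2)).
    exact: RotationS rot ew.
  by rewrite rev_cons last_cat /= last_rcons.
apply/implyP; rewrite {2}/safe wR orbF => sw.
have : stable w v.
  by move: IH; case: (Q1) => [|a Q3] /=; [case/andP | rewrite cat_path /= => /and4P[]].
rewrite /stable /= sw /= -/(adjP w v) => awv.
by case/andP: sw => _ /forallP/(_ v)/implyP/(_ vR); rewrite awv.
Qed.

(** Posa's lemma. A vertex [u] of [nbh R] is adjacent to the end of a rotated path [Q], and lies on
    [Q] by maximality. Rotating at [u] puts its successor on [Q] into [R], so [u] cannot be safe;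
    hence [u] has a neighbour on [P] in [R], and each vertex of [R] has at most two neighbours on
    [P]. *)
Lemma posa : #|nbh R| <= 2 * #|R|.
Proof.
have uP : uniq P by case: longP => /andP[].
(* Successor and predecessor on [P]. At the last vertex [f] returns the default [x], and at the head
   [g] returns [x] itself; this is harmless, since only the sizes of the two images matter. *)
pose f r := nth x P (index r P).+1; pose g r := nth x P (index r P).-1.
apply: leq_trans (_ : #|(f @: R) :|: (g @: R)| <= _); last first.
  by rewrite cardsU; have := leq_imset_card f R; have := leq_imset_card g R; lia.
apply/subset_leq_card/fintype.subsetP => u.
rewrite [u \in nbh R]inE finset.in_setD finset.in_setU => /andP[/andP[uR uS]].
case/existsP=> r /andP[rR eru].
have [Q rot lQ] : exists2 Q, rotation P Q & last x Q = r.
  by move: rR; rewrite inE => /asboolP.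
have pQ := rotation_perm rot.
have wQ := rotation_within rot (proj1 longP).
have hQ : head x Q = x by rewrite (rotation_head x rot).
have [_ maxQ] := longest_perm longP wQ pQ.
have nilQ : Q != [::] by rewrite -size_eq0 (perm_size pQ).
have uQ : u \in Q.
  apply: contraT => uQ; have := maxQ (rcons Q u); rewrite size_rcons ltnn => -> //.
  case/and3P: wQ => ? sQ aQ; apply/and3P; split; first by rewrite rcons_uniq uQ.
    by move: sQ lQ; case: (Q) => //= a Q0; rewrite rcons_path => -> ->.
  by rewrite all_rcons aQ andbT.
have stQ := rotation_stable rot.
move: uQ rot lQ stQ => /splitPr[Q1 [|v Q2]] rot lQ stQ.
  by case/negP: uR; move: lQ; rewrite last_cat /= => ->.
have vR : v \in R.
  rewrite inE; apply/asboolP; exists (Q1 ++ u :: rev (v :: Q2)).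
    by apply: RotationS rot _; rewrite e_sym; move: lQ; rewrite last_cat /= => ->.
  by rewrite rev_cons last_cat /= last_rcons.
have uvP : stable u v.
  by move: stQ; case: (Q1) => [|a Q3] /=; [case/andP | rewrite cat_path /= => /and4P[]].
have : ~~ [forall r in R, ~~ adjP u r].
  apply/negP => sf; have su : safe u by rewrite /safe uR.
  move: uvP; rewrite /stable /= su /= -/(adjP u v) => auv.
  by move/forallP/(_ v)/implyP/(_ vR): sf; rewrite auv.
have {}uP : u \in P by rewrite -(perm_mem (rotation_perm rot)) mem_cat mem_head orbT.
case/forallPn => q; rewrite negb_imply negbK => /andP[qR /orP[]] /eqP iq; apply/orP.
  by right; apply/imsetP; exists q; rewrite // /g iq /= nth_index.
by left; apply/imsetP; exists q; rewrite // /f -iq nth_index.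
Qed.
End Posa.

Definition ends (x : T) : {set T} :=
  [set y | `[< exists s, longest (x :: s) /\ last x s = y >]].

(** The ends reached by rotations are among [ends x], and by [posa] they form a set that does not
    expand. *)
Lemma ends_gt m x : expander m -> ends x != finset.set0 -> m < #|ends x|.
Proof.
move=> ex /set0Pn[y]; rewrite inE => /asboolP[s [lP _]].
have sub : rotation_ends x s \subset ends x.
  apply/fintype.subsetP => z; rewrite inE => /asboolP[Q rot lQ].
  rewrite inE; apply/asboolP; have := rotation_head x rot; have wQ := rotation_within rot lP.1.
  have := longest_perm lP wQ (rotation_perm rot).
  have := perm_size (rotation_perm rot).
  case: Q lQ {rot wQ} => //= a Q lQ _ lgQ ax; exists Q; split; last by rewrite -ax in lQ *.
  by rewrite -ax.
rewrite ltnNge; apply/negP => small.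
have := posa lP; rewrite leqNgt => /negP; apply; apply: ex.
  apply/fintype.subsetP => z; rewrite inE => /asboolP[Q rot lQ].
  case/and3P: (rotation_within rot lP.1) => _ _ /allP; apply.
  by have := perm_size (rotation_perm rot); case: Q lQ {rot} => //= a Q <- _; rewrite mem_last.
rewrite (leq_trans (subset_leq_card sub) small) andbT card_gt0; apply/set0Pn.
by exists (last x s); rewrite inE; apply/asboolP; exists (x :: s); first exact: Rotation0.
Qed.

Lemma ends_sym x y : (y \in ends x) = (x \in ends y).
Proof.
wlog suff : x y / y \in ends x -> x \in ends y by move=> h; apply/idP/idP; apply: h.
rewrite inE => /asboolP[s [lP lxy]]; rewrite inE; apply/asboolP.
case/lastP: s lxy lP => [|s z]; first by move=> <- lx; exists [::].
rewrite last_rcons => ->{z} lP; exists (rcons (rev s) x).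
rewrite last_rcons; split=> //.
have E : y :: rcons (rev s) x = rev (x :: rcons s y) by rewrite rev_cons rev_rcons.
apply: (longest_perm lP); rewrite E ?perm_rev //.
case/and3P: lP.1 => ? ? ?; apply/and3P; split; rewrite ?rev_uniq ?all_rev //.
by rewrite rev_sorted (eq_sorted (e' := e)).
Qed.

Lemma linked_exit Q : linked -> path_within Q -> Q != [::] -> size Q < #|S| ->
  exists x y, [/\ x \in Q, y \in S, y \notin Q & e x y].
Proof.
move=> lk /and3P[uQ _ aQ] nQ sQ.
have [||x [y [xQ yS exy]]] := lk [set z in Q].
- rewrite properEcard cardsE (card_uniqP uQ) sQ andbT.
  by apply/fintype.subsetP => z; rewrite inE => /(allP aQ).
- by case: Q nQ {uQ aQ sQ} => // a Q _; apply/set0Pn; exists a; rewrite inE mem_head.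
exists x, y; move: xQ yS; rewrite !inE => xQ /andP[-> ->]; by split.
Qed.

Lemma ends_irrefl x : linked -> 1 < #|S| -> x \notin ends x.
Proof.
move=> lk cS; apply/negP; rewrite inE => /asboolP[s [[wP mP] lx]].
have s0 : s = [::].
  case/lastP: s lx wP {mP} => // s z; rewrite last_rcons => -> /andP[] /=.
  by rewrite mem_rcons mem_head.
subst s; have [//|//|a [b [ax bS bx eab]]] := linked_exit lk wP.
suff /mP : path_within [:: a; b] by [].
move: ax bx eab; rewrite !inE => /eqP -> bx exb; case/and3P: wP => _ _ /andP[xS _].
by apply/and3P; split=> //=; rewrite ?inE ?exb ?bS ?andbT // eq_sym.
Qed.

(** The closing edge turns the path into a cycle. An edge leaves this cycle by connectivity, and
    cutting the cycle open where it leaves gives a longer path. The relation [e'] allows the closing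
    edge to be a new one. *)
Lemma longest_close (e' : rel T) x s : symmetric e' -> subrel e e' ->
  linked -> longest (x :: s) -> size (x :: s) < #|S| -> e' (last x s) x ->
  exists Q, [/\ uniq Q, sorted e' Q, all (mem S) Q & size (x :: s) < size Q].
Proof.
move=> sym' ee' lk [wP _] sP close.
have [a [b [aP bS bP eab]]] := linked_exit lk wP isT sP.
case/and3P: wP => uP sorP aP'.
have cP : cycle e' (x :: s) by rewrite /= rcons_path close (sub_path ee').
have [i s' def] := rot_to aP.
exists (b :: rot i (x :: s)); split.
- by rewrite /= mem_rot bP rot_uniq.
- move: cP; rewrite -(rot_cycle i) def /= rcons_path => /andP[-> _].
  by rewrite sym' ee'.
- by rewrite /= bS (eq_all_r (mem_rot i _)).
- by rewrite /= size_rot.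
Qed.
End Rotation.

(** * Connectivity of expanders and the number of boosters *)

Section Boosters.
Local Open Scope nat_scope.
Variable T : finType.
Implicit Types (e : rel T) (S X Y A : {set T}) (H E : {set {set T}}).

Definition joined e (m : nat) :=
  forall X Y, [disjoint X & Y] -> m <= #|X| -> m <= #|Y| ->
    exists x y, [/\ x \in X, y \in Y & e x y].

(** If [A] or its complement in [S] has at most [m] vertices, expansion of that side gives the edge;
    otherwise both are large and [joined] does. *)
Lemma expander_linked e S m :
  symmetric e -> joined e m -> expander e S m -> linked e S.
Proof.
move=> es jn ex A pA nA; have [sAS [z zS zA]] := properP pA.
have [Am | Am] := leqP #|A| m.
  have : 2 * #|A| < #|nbh e S A| by apply: ex; rewrite // card_gt0 nA.
  move/(leq_ltn_trans (leq0n _)); rewrite card_gt0 => /set0Pn[y].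
  by rewrite inE => /andP[yS /existsP[x /andP[xA exy]]]; exists x, y.
have [Bm | Bm] := leqP #|S :\: A| m.
  have : 2 * #|S :\: A| < #|nbh e S (S :\: A)|.
    apply: ex; rewrite ?finset.subsetDl // Bm andbT card_gt0.
    by apply/set0Pn; exists z; rewrite inE zA.
  move/(leq_ltn_trans (leq0n _)); rewrite card_gt0 => /set0Pn[y].
  rewrite inE => /andP[yS /existsP[x /andP[xA exy]]]; exists y, x; split=> //.
    by move: yS; rewrite !inE; case: (y \in A); case: (y \in S).
  by rewrite es.
apply: jn; rewrite ?(ltnW Am) ?(ltnW Bm) // finset.disjoints_subset.
by apply/fintype.subsetP => y yA; rewrite !inE yA.
Qed.

Lemma path_within_size (e : rel T) S Q : path_within e S Q -> size Q <= #|S|.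
Proof.
case/and3P=> /card_uniqP <- _ /allP aQ.
exact/subset_leq_card/fintype.subsetP.
Qed.

Lemma longest_exists e S : (S != finset.set0) -> exists x s, longest e S (x :: s).
Proof.
case/set0Pn=> z zS.
pose has_path k := `[< exists2 Q, path_within e S Q & size Q = k >].
have ex1 : has_path 1 by apply/asboolP; exists [:: z]; rewrite // /path_within /= zS.
have bnd k : has_path k -> k <= #|S|.
  by case/asboolP=> Q /path_within_size cQ <-.
case: (ex_maxnP (ex_intro _ 1 ex1) bnd) => k /asboolP[Q wQ sQ] mx.
have lQ : longest e S Q by split=> // Q' wQ'; rewrite sQ mx //; apply/asboolP; exists Q'.
case: Q lQ sQ {wQ} => [[_ /(_ [:: z])]|x s lQ _]; last by exists x, s.
by rewrite /path_within /= zS => /(_ isT).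
Qed.

Lemma adjacent_sym E : symmetric (Defs.adjacent E).
Proof. by move=> x y; rewrite /Defs.adjacent /= eq_sym finset.setUC. Qed.

Lemma adjacent_sub E E' : E \subset E' -> subrel (Defs.adjacent E) (Defs.adjacent E').
Proof. by move=> /fintype.subsetP sE x y; rewrite /Defs.adjacent /= => /andP[-> /sE]. Qed.

Definition boosters S H : {set {set T}} :=
  [set f in vertex_pairs T | `[< exists2 Q, path_within (Defs.adjacent (f |: H)) S Q &
     forall Q', path_within (Defs.adjacent H) S Q' -> size Q' < size Q >]].

Lemma boosters_pairs S H : boosters S H \subset vertex_pairs T.
Proof. by apply/fintype.subsetP => f; rewrite inE => /andP[]. Qed.

Lemma boosters_disjoint S H f : f \in boosters S H -> f \notin H.
Proof.
rewrite inE => /andP[_ /asboolP[Q wQ mQ]]; apply/negP => fH.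
have := mQ Q; rewrite ltnn -{1}(_ : f |: H = H) => [/(_ wQ)//|].
by apply/finset.setUidPr; rewrite finset.sub1set.
Qed.

(** A start [x] of a longest path has more than [m] ends [r], and each [r], taken as a start in
    turn, has more than [m] ends [y]. The pair of [r] and [y] closes a longest path, so it is a
    booster by [longest_close]. *)
Lemma boosters_card m S H :
    expander (Defs.adjacent H) S m -> linked (Defs.adjacent H) S -> 1 < #|S| ->
    (forall Q, path_within (Defs.adjacent H) S Q -> size Q < #|S|) ->
  m * m <= 4 * #|boosters S H|.
Proof.
move=> ex lk S1 short.
have [|x [s lP]] := @longest_exists (Defs.adjacent H) S.
  by rewrite -card_gt0 ltnW.
have es := adjacent_sym H.
pose O := [set p : T * T | (p.1 \in ends (Defs.adjacent H) S x) &&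
                           (p.2 \in ends (Defs.adjacent H) S p.1)].
have nx : ends (Defs.adjacent H) S x != finset.set0.
  by apply/set0Pn; exists (last x s); rewrite inE; apply/asboolP; exists s.
have cO : m * m <= #|O|.
  have -> : #|O| = \sum_(r in ends (Defs.adjacent H) S x) #|ends (Defs.adjacent H) S r|.
    rewrite -sum1_card; under [RHS]eq_bigr do rewrite -sum1_card.
    by rewrite pair_big_dep /=; apply: eq_bigl => p; rewrite inE.
  apply: leq_trans (_ : \sum_(r in ends (Defs.adjacent H) S x) m <= _).
    by rewrite sum_nat_const leq_mul2r ltnW ?orbT ?ends_gt.
  apply: leq_sum => r rx; apply/ltnW/ends_gt => //; apply/set0Pn; exists x.
  by rewrite ends_sym.
apply: leq_trans cO _.
(* The pairs (r, y) are ordered; each booster [f] accounts for at most the four elements of its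
   square, whence the factor 4. *)
apply: leq_trans (_ : #|(\bigcup_(f in boosters S H) finset.setX f f)%SET| <= _).
  apply/subset_leq_card/fintype.subsetP => -[r y]; rewrite inE /= => /andP[_ yr].
  apply/finset.bigcupP; exists [set r; y]; last by rewrite !inE !eqxx orbT.
  have ry : r != y by apply: contraTneq yr => <-; apply: ends_irrefl.
  move: yr; rewrite inE => /asboolP[s' [lP' ly]].
  rewrite inE inE cards2 ry; apply/asboolP.
  have [|||Q [uQ sQ aQ lt]] := @longest_close _ _ _
    (Defs.adjacent ([set r; y] |: H)) r s' (adjacent_sym _) _ lk lP'.
  - exact/adjacent_sub/finset.subsetUr.
  - by apply: short; case: lP'.
  - by rewrite ly /Defs.adjacent /= eq_sym ry finset.setUC !inE eqxx.
  exists Q; first by rewrite /path_within uQ sQ.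
  by move=> Q' wQ'; apply: leq_ltn_trans lt; apply: lP'.2.
apply: leq_trans (_ : \sum_(f in boosters S H) #|finset.setX f f| <= _).
  elim/big_rec2: _ => [|f a A _ le]; first by rewrite cards0.
  by apply: leq_trans (leq_card_setU _ _) _; rewrite leq_add2l.
rewrite mulnC -sum_nat_const leq_sum // => f; rewrite inE inE cardsX => /andP[/eqP-> _].
by [].
Qed.

End Boosters.

(** * Deleting vertices while keeping every remaining colour repeated *)

Section Pruning.
Local Open Scope nat_scope.
Variables (T C : finType) (phi : T -> C).
Implicit Types (S A : {set T}).

Definition repeating S :=
  [forall x in S, exists y in S, (y != x) && (phi y == phi x)].

Definition survivors S A : {set T} :=
  [set x in S :\: A | [exists y in S :\: A, (y != x) && (phi y == phi x)]].

Lemma survivors_sub S A : survivors S A \subset S :\: A.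
Proof. by apply/fintype.subsetP => x; rewrite inE => /andP[]. Qed.

Lemma survivors_anti S A A' : A \subset A' -> survivors S A' \subset survivors S A.
Proof.
move=> /(finset.setDS S)/fintype.subsetP AA'; apply/fintype.subsetP => x.
rewrite inE => /andP[/AA' xA /existsP[y /andP[/AA' yA h]]].
by rewrite inE xA; apply/existsP; exists y; rewrite yA.
Qed.

(** One pass of deletions suffices: the partner of a survivor has that survivor as its own partner,
    so it survives too. *)
Lemma survivors_repeating S A : repeating (survivors S A).
Proof.
apply/forallP => x; apply/implyP; rewrite inE => /andP[xA /existsP[y /and3P[yA yx h]]].
apply/existsP; exists y; rewrite yx h inE yA !andbT /=.
by apply/existsP; exists x; rewrite xA eq_sym yx eq_sym h.
Qed.

(* Every vertex lost besides A is the only one of its colour outside A, and its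
   colour occurs in A. *)
Lemma survivors_card S A : repeating S -> #|S| <= #|survivors S A| + 2 * #|A|.
Proof.
move=> /forallP rS; pose L := (S :\: A) :\: survivors S A.
have LA : #|L| <= #|A|.
  rewrite -(card_in_imset (f := phi)) => [|x y].
    apply: leq_trans (leq_imset_card phi A).
    apply/subset_leq_card/fintype.subsetP => _ /imsetP[x xL ->].
    move: xL; rewrite inE [x \in survivors S A]inE => /andP[xn xSA].
    move: xn; rewrite xSA /= => /existsPn xn.
    have xS := fintype.subsetP (finset.subsetDl _ _) _ xSA.
    have /existsP[y /and3P[yS yx /eqP yp]] := implyP (rS x) xS.
    apply/imsetP; exists y => //; move: (xn y); rewrite inE yS yx yp eqxx !andbT.
    by rewrite negbK.
  rewrite inE [x \in survivors S A]inE => /andP[xn xSA] /finset.setDP[ySA _] /eqP xy.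
  move: xn; rewrite xSA /= => /existsPn/(_ y).
  by rewrite ySA (eq_sym (phi y)) xy andbT /= negbK eq_sym => /eqP.
have : #|S| <= #|survivors S A :|: (A :|: L)|.
  apply/subset_leq_card/fintype.subsetP => x xS.
  by rewrite !(finset.in_setU, finset.in_setD) xS; case: (x \in A); case: (x \in survivors S A).
have := (leq_card_setU (survivors S A) (A :|: L)).1; have := (leq_card_setU A L).1.
lia.
Qed.

Lemma repeating_expander (e : rel T) m S :
    joined e m -> repeating S -> 9 * m <= #|S| ->
  exists S', [/\ S' \subset S, repeating S', expander e S' m & 7 * m <= #|S'|].
Proof.
move=> jn rS big.
(* A largest set A that expands badly: joinedness forces #|A| < m, and then a
   badly expanding X could be added to A. *)
pose P A := (#|A| <= 2 * m) && (#|nbh e (survivors S A) A| <= 2 * #|A|).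
have P0 : P finset.set0.
  rewrite /P cards0 leqn0 cards_eq0; apply/eqP/setP => y; rewrite !inE.
  by apply/negP => /andP[_ /existsP[x]]; rewrite inE.
case: (arg_maxnP (fun A => #|A|) P0) => A /andP[A2 nA] maxA.
have cA := survivors_card A rS.
have Am : #|A| < m.
  rewrite ltnNge; apply/negP => mA.
  (* When m <= |A| <= 2m, at least 9m - 2|A| - 2|A| >= m survivors lie outside the neighbourhood of
     [A], yet [joined] gives an edge from [A] to one of them. This is the source of the 9. *)
  have [|||x [y [xA yY exy]]] := jn A (survivors S A :\: nbh e (survivors S A) A) => //.
  - rewrite disjoint_sym finset.disjoints_subset; apply/fintype.subsetP => y.
    by rewrite inE => /andP[_ /(fintype.subsetP (survivors_sub S A))]; rewrite !inE => /andP[].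
  - have := cardsID (nbh e (survivors S A) A) (survivors S A).
    have := subset_leq_card (finset.subsetIr (survivors S A) (nbh e (survivors S A) A)).
    lia.
  move: yY; rewrite inE => /andP[yn ys]; case/negP: yn.
  have := fintype.subsetP (survivors_sub S A) _ ys; rewrite !(finset.in_setD) => /andP[yA _].
  by rewrite inE finset.in_setD yA ys; apply/existsP; exists x; rewrite xA.
exists (survivors S A); split; last lia.
- exact: fintype.subset_trans (survivors_sub S A) (finset.subsetDl _ _).
- exact: survivors_repeating.
move=> X XS /andP[X0 Xm]; rewrite ltnNge; apply/negP => nX.
have dAX : [disjoint A & X].
  rewrite disjoint_sym finset.disjoints_subset; apply/fintype.subsetP => y.
  by move=> /(fintype.subsetP XS)/(fintype.subsetP (survivors_sub S A)); rewrite !inE => /andP[].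
have cAX : #|A :|: X| = #|A| + #|X| by rewrite cardsU (disjoint_setI0 dAX) cards0 subn0.
(* The union has at most 2m vertices. Survivors only decrease as the deleted set grows, so its
   neighbours are neighbours of [A] or of [X] among the old survivors, at most 2|A| + 2|X| in
   number. *)
suff /maxA : P (A :|: X) by rewrite /= cAX; lia.
rewrite /P cAX; apply/andP; split; first lia.
apply: leq_trans (_ : #|nbh e (survivors S A) A :|: nbh e (survivors S A) X| <= _); last first.
  by have := (leq_card_setU (nbh e (survivors S A) A) (nbh e (survivors S A) X)).1; lia.
apply/subset_leq_card/fintype.subsetP => y.
rewrite inE finset.in_setD => /andP[/andP[yn ys] /existsP[x /andP[xAX exy]]].
have {}ys := fintype.subsetP (survivors_anti S (finset.subsetUl A X)) _ ys.
move: yn xAX; rewrite !finset.in_setU negb_or => /andP[yA yX] /orP[xA | xX]; apply/orP.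
  by left; rewrite inE finset.in_setD yA ys; apply/existsP; exists x; rewrite xA.
by right; rewrite inE finset.in_setD yX ys; apply/existsP; exists x; rewrite xX.
Qed.

(** Deleting one vertex costs at most two by [survivors_card], so a smallest repeating subset with
    at least [s] vertices has at most s + 2. The upper bound keeps the later sum over [Gam]
    cheap. *)
Lemma repeating_trim s S : repeating S -> s <= #|S| ->
  exists S', [/\ S' \subset S, repeating S' & s <= #|S'| <= s + 2].
Proof.
move=> rS sS; pose P A := [&& A \subset S, repeating A & s <= #|A|].
have PS : P S by rewrite /P fintype.subxx rS.
case: (arg_minnP (fun A => #|A|) PS) => A /and3P[AS rA sA] minA.
exists A; split=> //; rewrite sA leqNgt; apply/negP => big.
have /set0Pn[x xA] : A != finset.set0 by rewrite -card_gt0; lia.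
have := survivors_card [set x] rA; rewrite cards1.
have sub : survivors A [set x] \subset A :\ x by exact: survivors_sub.
move=> cA; have /minA : P (survivors A [set x]).
  rewrite /P survivors_repeating (fintype.subset_trans sub) /=; first lia.
  exact: fintype.subset_trans (finset.subsetDl _ _) AS.
by have := subset_leq_card sub; have := cardsD1 x A; rewrite xA; lia.
Qed.

End Pruning.

(** * Lengthening paths with second-round edges *)

Section Sprinkling.
Local Open Scope nat_scope.
Variable T : finType.
Implicit Types (S X Y A : {set T}) (H Gam : {set {set T}}).

Lemma path_within_sub (e e' : rel T) S Q :
  subrel e e' -> path_within e S Q -> path_within e' S Q.
Proof.
move=> ee' /and3P[uQ sQ aQ]; apply/and3P; split=> //.
by case: Q sQ {uQ aQ} => //= x Q; apply: sub_path.
Qed.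

Lemma expander_subrel (e e' : rel T) S m :
  subrel e e' -> expander e S m -> expander e' S m.
Proof.
move=> ee' ex A AS Am; apply: leq_trans (ex A AS Am) _.
apply/subset_leq_card/fintype.subsetP => y; rewrite !inE => /andP[->] /=.
by case/existsP=> x /andP[xA /ee' h]; apply/existsP; exists x; rewrite xA.
Qed.

Lemma joined_subrel (e e' : rel T) m : subrel e e' -> joined e m -> joined e' m.
Proof.
move=> ee' jn X Y d mX mY; have [x [y [? ? /ee']]] := jn X Y d mX mY.
by exists x, y.
Qed.

(** The bad event for given [S], [H] and [Gam]. Its last two conditions make [H2] contain one set of
    pairs and avoid another, disjoint from it by [boosters_disjoint], so that the probability is a
    product. *)
Definition trap (m L : nat) S H Gam H2 :=
  [&& #|Gam| <= L, m * m <= 4 * #|boosters S (H :|: Gam)|, Gam \subset H2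
    & [disjoint boosters S (H :|: Gam) & H2]].

Lemma hamiltonian_of_no_trap m S H1 H2 :
    1 < #|S| -> joined (Defs.adjacent H1) m -> expander (Defs.adjacent H1) S m ->
    (forall Gam, ~~ trap m #|S| S H1 Gam H2) ->
  exists2 Q, path_within (Defs.adjacent (H1 :|: H2)) S Q & size Q = #|S|.
Proof.
move=> S1 jn ex nt.
(* A largest set of second-round edges each of which lengthened a longest path. *)
pose P Gam := (Gam \subset H2) &&
  `[< exists2 Q, path_within (Defs.adjacent (H1 :|: Gam)) S Q & #|Gam| <= size Q >].
have P0 : P finset.set0.
  by rewrite /P finset.sub0set; apply/asboolP; exists [::]; rewrite ?cards0.
case: (arg_maxnP (fun Gam => #|Gam|) P0) => Gam /andP[GH /asboolP[Q0 wQ0 sQ0]] maxG.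
have subG : H1 \subset H1 :|: Gam := finset.subsetUl _ _.
have [[Q wQ sQ] | short] := pselect (exists2 Q,
    path_within (Defs.adjacent (H1 :|: Gam)) S Q & #|S| <= size Q).
  exists Q; last by apply/eqP; rewrite eqn_leq sQ (path_within_size wQ).
  by apply: path_within_sub wQ; apply/adjacent_sub/finset.setUS.
have bc : m * m <= 4 * #|boosters S (H1 :|: Gam)|.
  apply: boosters_card => //.
  - exact: expander_subrel (adjacent_sub subG) ex.
  - apply: expander_linked (adjacent_sym _) _ (expander_subrel (adjacent_sub subG) ex).
    exact: joined_subrel (adjacent_sub subG) jn.
  - by move=> Q wQ; rewrite ltnNge; apply/negP => sQ; apply: short; exists Q.
(* The path [Q0] gives |Gam| <= |S|, so the absence of traps yields a booster [f] in [H2]. It is not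
   in [Gam], and adding it to [Gam] contradicts maximality. *)
have := nt Gam; rewrite /trap bc GH (leq_trans sQ0 (path_within_size wQ0)) /=.
rewrite -setI_eq0 => /set0Pn[f]; rewrite inE => /andP[fB fH].
have := boosters_disjoint fB; rewrite inE negb_or => /andP[_ fG].
move: fB; rewrite inE => /andP[_ /asboolP[Q wQ /(_ Q0 wQ0) lt]].
have cf : #|f |: Gam| = #|Gam|.+1 by rewrite cardsU1 fG.
suff /maxG : P (f |: Gam) by rewrite /= cf ltnn.
rewrite /P finset.subUset finset.sub1set fH GH; apply/asboolP; exists Q.
  by rewrite finset.setUCA.
by rewrite cf; apply: leq_ltn_trans lt.
Qed.

Lemma no_linear_colouring (e : rel T) k (phi : T -> 'I_k) S Q :
    repeating phi S -> S != finset.set0 -> path_within e S Q -> size Q = #|S| ->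
  ~ linear_colouring e phi.
Proof.
move=> /forallP rS S0 /and3P[uQ pQ aQ] sQ lin.
have def : [set v in Q] = S.
  apply/eqP; rewrite eqEcard cardsE (card_uniqP uQ) sQ leqnn andbT.
  by apply/fintype.subsetP => v; rewrite inE => /(allP aQ).
have [|v [vS cv]] := lin S.
  case: Q uQ pQ def {aQ sQ} => [|x s] uQ pQ def; last by exists x, s; split.
  by case/set0Pn: S0 => x; rewrite -def inE.
have /existsP[w /and3P[wS wv /eqP ww]] := implyP (rS v) vS.
by apply: (cv w wS wv).
Qed.

(** If k + 9m <= |T|, the vertices alone in their colour number at most k, so at least 9m vertices
    have a repeated colour. These are trimmed to at most 9m + 2 before pruning to an expander, whose
    Hamiltonian path has no centre. *)
Lemma chi_lin_gt m H1 H2 :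
    0 < m -> joined (Defs.adjacent H1) m ->
    (forall S Gam, ~~ trap m (9 * m + 2) S H1 Gam H2) ->
  #|T| < chi_lin (Defs.adjacent (H1 :|: H2)) + 9 * m.
Proof.
move=> m0 jn nt; rewrite /chi_lin.
case: ex_minnP => k /asboolP[phi lin] _; rewrite ltnNge; apply/negP => big.
pose S0 := survivors phi [set: T] finset.set0.
have rS0 : repeating phi S0 by exact: survivors_repeating.
have cS0 : 9 * m <= #|S0|.
  suff : #|~: S0| <= k by have := cardsC S0; lia.
  rewrite -[k in _ <= k]card_ord -(card_in_imset (f := phi)) ?max_card // => x y.
  rewrite !inE /= => /existsPn/(_ y); rewrite !inE /= => xy _ pxy.
  by apply/eqP; rewrite eq_sym; move: xy; rewrite pxy eqxx andbT negbK.
have [S1 [_ rS1 /andP[c1 c2]]] := repeating_trim rS0 cS0.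
have [S [SS rS ex cS]] := repeating_expander jn rS1 c1.
have cSL := leq_trans (subset_leq_card SS) c2.
have [||Q wQ sQ] := @hamiltonian_of_no_trap m S H1 H2 _ jn ex; first lia.
  move=> Gam; apply: contra (nt S Gam) => /and4P[le b sub d].
  by apply/and4P; split=> //; apply: leq_trans cSL.
by apply: (no_linear_colouring rS _ wQ sQ lin); rewrite -card_gt0; lia.
Qed.

End Sprinkling.

(** * Product measures on the subsets of a finite set *)

Section Weight.
Local Open Scope ring_scope.
Variables (R : realType) (I : finType).
Implicit Types (p q : I -> R) (A B E : {set I}).

Definition weight p E := \prod_i (if i \in E then p i else 1 - p i).

(** Here [c i b] says whether the state [b] is allowed at [i]. An event that constrains each
    coordinate separately is the expansion of a product of two-term sums. *)
Lemma sum_weight_local p (c : I -> bool -> bool) :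
  \sum_(E : {set I} | [forall i, c i (i \in E)]) weight p E =
  \prod_i ((if c i true then p i else 0) + (if c i false then 1 - p i else 0)).
Proof.
rewrite bigA_distr big_mkcond /=; apply: eq_bigr => E _.
case: ifPn => [/forallP h | /forallPn[i /negbTE h]].
  by apply: eq_bigr => i _; move: (h i); case: ifP => _ ->.
by rewrite (bigD1 i) //=; move: h; case: ifP => _ ->; rewrite mul0r.
Qed.

Lemma sum_weight p : \sum_(E : {set I}) weight p E = 1.
Proof.
transitivity (\sum_(E : {set I} | [forall i : I, true]) weight p E).
  by apply: eq_bigl => E; apply/esym/forallP.
apply: etrans (sum_weight_local p (fun _ _ => true)) _.
by rewrite big1 // => i _; rewrite addrC subrK.
Qed.

Lemma sum_weight_box p A B : [disjoint A & B] ->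
  \sum_(E : {set I} | (A \subset E) && [disjoint B & E]) weight p E =
  (\prod_(i in A) p i) * \prod_(i in B) (1 - p i).
Proof.
move=> dAB; rewrite (eq_bigl (fun E : {set I} =>
    [forall i, ((i \in A) ==> (i \in E)) && ((i \in B) ==> ~~ (i \in E))])); last first.
  move=> E; apply/andP/forallP => [[/fintype.subsetP AE BE] i | h].
    apply/andP; split; apply/implyP; first exact: AE.
    by move=> iB; rewrite (disjointFr BE iB).
  split; first by apply/fintype.subsetP => i iA; have /andP[/implyP/(_ iA)] := h i.
  rewrite finset.disjoints_subset; apply/fintype.subsetP => i iB; rewrite inE.
  by have /andP[_ /implyP/(_ iB)] := h i.
rewrite (sum_weight_local p (fun i b => ((i \in A) ==> b) && ((i \in B) ==> ~~ b))).
rewrite [X in _ = X * _]big_mkcond [X in _ = _ * X]big_mkcond -big_split /=.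
apply: eq_bigr => i _; have := disjointFr dAB (x := i).
case: (i \in A) => [/(_ isT)->|_] /=; first by rewrite addr0 mulr1.
by case: (i \in B); rewrite ?add0r ?mul1r // addrC subrK.
Qed.

(** The union of two independent random sets is again a random set. Group [E2] by the value [E] of
    the union; for each [E] the remaining double sum factorises over coordinates. *)
Lemma weight_union p q (F : {set I} -> R) :
  \sum_(E1 : {set I}) weight p E1 * \sum_(E2 : {set I}) weight q E2 * F (E1 :|: E2) =
  \sum_(E : {set I}) weight (fun i => p i + q i - p i * q i) E * F E.
Proof.
under eq_bigr => E1 _.
  rewrite (partition_big (fun E2 => E1 :|: E2) xpredT) //=.
  under eq_bigr => E _.
    rewrite (eq_bigr (fun E2 => weight q E2 * F E)); last by move=> E2 /eqP->.
    rewrite -mulr_suml.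
    rewrite (eq_bigl (fun E2 : {set I} =>
      [forall i, ((i \in E1) || (i \in E2)) == (i \in E)])); last first.
      move=> E2; apply/eqP/forallP => [<- i | h]; first by rewrite inE.
      by apply/setP => i; rewrite inE; apply/eqP/h.
    rewrite (sum_weight_local q (fun i b => ((i \in E1) || b) == (i \in E))).
    over.
  rewrite mulr_sumr; over.
rewrite exchange_big /=; apply: eq_bigr => E _.
under eq_bigr do rewrite mulrA; rewrite -mulr_suml; congr (_ * _).
under eq_bigr do rewrite /weight -big_split /=.
rewrite /weight [LHS](eq_bigr (fun E1 : {set I} => \prod_i (if i \in E1 then
   (if i \in E then p i else 0) else (1 - p i) * (if i \in E then q i else 1 - q i)))).
  rewrite -bigA_distr; apply: eq_bigr => i _; case: (i \in E) => /=; ring.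
move=> E1 _; apply: eq_bigr => i _; case: (i \in E1); case: (i \in E) => /=;
  rewrite ?eqxx /= ?addr0 ?add0r ?mulr0 //; by rewrite addrC subrK mulr1.
Qed.

Lemma weight_ge0 p E : (forall i, 0 <= p i <= 1) -> 0 <= weight p E.
Proof.
move=> p01'; apply: prodr_ge0 => i _; have /andP[p0 p1] := p01' i.
by case: ifP; rewrite ?subr_ge0.
Qed.

Lemma union_bound (J : finType) p (a : pred {set I}) (b : J -> pred {set I}) :
  (forall i, 0 <= p i <= 1) -> (forall E, a E -> exists j, b j E) ->
  \sum_(E : {set I} | a E) weight p E <=
  \sum_j \sum_(E : {set I} | b j E) weight p E.
Proof.
move=> p01' ab; rewrite (exchange_big_dep xpredT) //= big_mkcond.
apply: ler_sum => E _; case: ifP => [/ab[j bj]|_]; last first.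
  by apply: sumr_ge0 => j _; exact: weight_ge0.
by rewrite (bigD1 j) //= lerDl; apply: sumr_ge0 => k _; exact: weight_ge0.
Qed.

End Weight.

(** * Failure probabilities of the two rounds *)

Section TwoRounds.
Local Open Scope ring_scope.
Variables (R : realType) (n : nat).
Let T := 'I_n : finType.
Implicit Types (p q : R) (E H Gam : {set {set T}}) (X Y S : {set T}).

(* It vanishes off vertex_pairs so that sums may range over all set families. *)
Definition pair_prob p (f : {set T}) : R := if f \in vertex_pairs T then p else 0.

Lemma pair_prob01 p f : 0 <= p <= 1 -> 0 <= pair_prob p f <= 1.
Proof. by move=> p01; rewrite /pair_prob; case: ifP => // _; rewrite lexx ler01. Qed.

Lemma gnp_probE p (A : pred (rel T)) :
  gnp_prob p A = \sum_(E | A (Defs.adjacent E)) weight (pair_prob p) E.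
Proof.
rewrite /gnp_prob [RHS](bigID (fun E => E \subset vertex_pairs T)) /=.
rewrite [X in _ = _ + X]big1 ?addr0 => [|E /andP[_ /subsetPn[f fE fV]]]; last first.
  by rewrite /weight (bigD1 f) //= fE /pair_prob (negbTE fV) mul0r.
apply: eq_big => E; first by rewrite powersetE andbC.
rewrite powersetE => /andP[/fintype.subsetP EV _].
rewrite /weight big_mkcond /=; apply: eq_bigr => f _; rewrite /pair_prob.
case: ifP => // fV; case: ifP => [/EV|_]; first by rewrite fV.
by rewrite subr0.
Qed.

Lemma gnp_prob_union p q (A : pred (rel T)) :
  gnp_prob (p + q - p * q) A =
  \sum_E weight (pair_prob p) E *
    \sum_(H | A (Defs.adjacent (E :|: H))) weight (pair_prob q) H.
Proof.
rewrite gnp_probE big_mkcond /=.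
under [RHS]eq_bigr => E _.
  rewrite big_mkcond /=.
  rewrite (eq_bigr (fun H => weight (pair_prob q) H *
    (A (Defs.adjacent (E :|: H)))%:R)); last by move=> H _; case: ifP; rewrite (mulr1, mulr0).
  over.
rewrite (weight_union (pair_prob p) (pair_prob q) (fun E => (A (Defs.adjacent E))%:R)).
apply: eq_bigr => E _; rewrite (_ : weight _ _ = weight (pair_prob (p + q - p * q)) E).
  by case: ifP; rewrite (mulr1, mulr0).
apply: eq_bigr => f _; rewrite /pair_prob; case: (f \in vertex_pairs T) => //.
by rewrite mul0r subr0 addr0.
Qed.

Lemma card_vertex_pairs : (#|vertex_pairs T| <= n ^ 2)%N.
Proof.
have := card_draws T 2; rewrite card_ord /vertex_pairs => ->.
by rewrite bin2 -divn2 -mulnn; apply: leq_trans (leq_div _ _) _; rewrite leq_mul2l leq_pred orbT.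
Qed.

Definition cross_pairs X Y : {set {set T}} := [set [set x; y] | x in X, y in Y].

Lemma cross_pairs_sub X Y : [disjoint X & Y] -> cross_pairs X Y \subset vertex_pairs T.
Proof.
move=> d; apply/fintype.subsetP => _ /imset2P[x y xX yY ->]; rewrite inE cards2.
by rewrite (contraTneq _ yY) // => <-; rewrite (disjointFr d xX).
Qed.

Lemma card_cross_pairs X Y : [disjoint X & Y] -> #|cross_pairs X Y| = (#|X| * #|Y|)%N.
Proof.
move=> d; rewrite /cross_pairs curry_imset2X card_in_imset ?cardsX //.
move=> [x y] [x' y'] /finset.setXP[xX yY] /finset.setXP[xX' yY'] /= E.
have nXY a b : a \in X -> b \in Y -> (a == b) = false.
  by move=> aX bY; apply: contraTF bY => /eqP <-; rewrite (disjointFr d aX).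
have : x \in [set x'; y'] by rewrite -E finset.set21.
rewrite !inE (nXY x y') // orbF => /eqP->.
have : y \in [set x'; y'] by rewrite -E finset.set22.
by rewrite !inE eq_sym (nXY x' y) // => /eqP->.
Qed.

Lemma card_sets (I : finType) : #|{: {set I}}| = (2 ^ #|I|)%N.
Proof. by rewrite -[in RHS]cardsT -card_powerset powersetT cardsT. Qed.

(** Union bound over the 4^n choices of two vertex sets; two disjoint sets of size at least [m]
    determine at least m^2 distinct pairs, all absent. *)
Lemma prob_not_joined p m : 0 <= p <= 1 ->
  \sum_(E | ~~ `[< joined (Defs.adjacent E) m >]) weight (pair_prob p) E <=
  4 ^+ n * (1 - p) ^+ (m * m).
Proof.
move=> p01; have pf01 f := pair_prob01 f p01.
have p1 : 0 <= 1 - p <= 1 by lra.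
pose b (XY : {set T} * {set T}) := [pred E : {set {set T}} |
  [&& [disjoint XY.1 & XY.2], (m <= #|XY.1|)%N, (m <= #|XY.2|)%N
    & [disjoint cross_pairs XY.1 XY.2 & E]]].
apply: le_trans (union_bound (b := b) pf01 _) _.
  move=> E /asboolPn nj; apply: contrapT => nb; apply: nj => X Y d mX mY.
  apply: contrapT => ne; apply: nb; exists (X, Y); rewrite /= d mX mY /=.
  rewrite finset.disjoints_subset; apply/fintype.subsetP => _ /imset2P[x y xX yY ->].
  rewrite inE; apply/negP => xyE; apply: ne; exists x, y; split=> //.
  rewrite /Defs.adjacent /= xyE andbT; apply: contraTneq yY => <-.
  by rewrite (disjointFr d xX).
apply: le_trans (_ : \sum_(XY : {set T} * {set T}) (1 - p) ^+ (m * m) <= _); last first.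
  rewrite sumr_const card_prod card_sets card_ord -[X in X <= _]mulr_natl natrM natrX.
  by rewrite -exprMn -natrM.
apply: ler_sum => -[X Y] _; rewrite /b /=.
case: (boolP [&& [disjoint X & Y], (m <= #|X|)%N & (m <= #|Y|)%N]); last first.
  move=> h; rewrite big_pred0 ?exprn_ge0 //; first by case/andP: p1.
  by move=> E; apply: contraNF h => /= /and4P[-> -> ->].
case/and3P=> d mX mY; rewrite (eq_bigl (fun E : {set {set T}} =>
  (finset.set0 \subset E) && [disjoint cross_pairs X Y & E])); last first.
  by move=> E; rewrite /= d mX mY finset.sub0set.
rewrite sum_weight_box; last by rewrite finset.disjoints_subset finset.sub0set.
rewrite big_set0 mul1r (eq_bigr (fun=> 1 - p)) => [|f fX]; last first.
  by rewrite /pair_prob (fintype.subsetP (cross_pairs_sub d) _ fX).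
rewrite prodr_const card_cross_pairs // ler_wiXn2l //; try by case/andP: p1.
exact: leq_mul.
Qed.

(* The parameter w trades the bound #|Gam| <= L for a geometric weight: p^|Gam| <=
   w^L (p / w)^|Gam|, and the sum over Gam becomes a product over pairs. *)
Lemma prob_trap p (w : R) m L E : 0 <= p <= 1 -> 1 <= w ->
  \sum_(H | [exists x : {set T} * {set {set T}}, trap m L x.1 E x.2 H])
     weight (pair_prob p) H <=
  2 ^+ n * (w ^+ L * (1 + p / w) ^+ (n ^ 2) * (1 - p) ^+ (m * m %/ 4)).
Proof.
move=> p01 w1; have pf01 f := pair_prob01 f p01.
have p1 : 0 <= 1 - p <= 1 by lra.
have w0 : 0 < w by lra.
pose b (x : {set T} * {set {set T}}) := [pred H | trap m L x.1 E x.2 H].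
apply: le_trans (union_bound (b := b) pf01 _) _; first by move=> H /existsP.
rewrite -(pair_big xpredT xpredT (fun S Gam =>
  \sum_(H | trap m L S E Gam H) weight (pair_prob p) H)) /=.
apply: le_trans (_ : \sum_(S : {set T})
  (w ^+ L * (1 + p / w) ^+ (n ^ 2) * (1 - p) ^+ (m * m %/ 4)) <= _); last first.
  by rewrite sumr_const card_sets card_ord -[X in X <= _]mulr_natl natrX.
apply: ler_sum => S _.
apply: le_trans (_ : \sum_(Gam : {set {set T}})
  (w ^+ L * (\prod_(f in Gam) (pair_prob p f / w)) * (1 - p) ^+ (m * m %/ 4)) <= _);
  last first.
  rewrite -mulr_suml -mulr_sumr ler_wpM2r ?exprn_ge0 //; first by case/andP: p1.
  rewrite ler_wpM2l ?exprn_ge0 ?(ltW w0) //.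
  (* Summing over all [Gam] turns the products into one product of factors 1 + p / w over the vertex
     pairs; other sets contribute a factor 1. *)
  under eq_bigr do rewrite big_mkcond; rewrite -bigA_distr /=.
  rewrite (bigID (mem (vertex_pairs T))) /= [X in _ * X]big1 => [|f /negbTE fV]; last first.
    by rewrite /pair_prob fV mul0r add0r.
  rewrite mulr1 (eq_bigr (fun=> 1 + p / w)) => [|f fV]; last by rewrite /pair_prob fV addrC.
  rewrite prodr_const ler_weXn2l ?card_vertex_pairs // lerDl divr_ge0 ?(ltW w0) //.
  by case/andP: p01.
apply: ler_sum => Gam _.
case: (boolP ((#|Gam| <= L)%N && (m * m <= 4 * #|boosters S (E :|: Gam)|)%N)); last first.
  move=> h; rewrite big_pred0 => [|H]; last first.
    by apply: contraNF h => /and4P[-> ->].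
  rewrite !mulr_ge0 ?exprn_ge0 ?(ltW w0) //; last by case/andP: p1.
  by apply: prodr_ge0 => f _; rewrite divr_ge0 ?(ltW w0) //; case/andP: (pf01 f).
case/andP=> GL bm; rewrite (eq_bigl (fun H =>
  (Gam \subset H) && [disjoint boosters S (E :|: Gam) & H])); last first.
  by move=> H; rewrite /trap GL bm.
rewrite sum_weight_box; last first.
  rewrite disjoint_sym finset.disjoints_subset; apply/fintype.subsetP => f /boosters_disjoint.
  by rewrite !inE negb_or => /andP[].
have prod0 : 0 <= \prod_(f in Gam) (pair_prob p f / w).
  by apply: prodr_ge0 => f _; rewrite divr_ge0 ?(ltW w0) //; case/andP: (pf01 f).
apply: ler_pM.
- by apply: prodr_ge0 => f _; case/andP: (pf01 f).
- by apply: prodr_ge0 => f _; rewrite subr_ge0; case/andP: (pf01 f).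
- rewrite (eq_bigr (fun f => w * (pair_prob p f / w))) => [|f _]; last first.
    by rewrite mulrCA divff ?mulr1 ?gt_eqF.
  by rewrite big_split prodr_const /= ler_wpM2r // ler_weXn2l.
rewrite (eq_bigr (fun=> 1 - p)) => [|f fB]; last first.
  by rewrite /pair_prob (fintype.subsetP (boosters_pairs _ _) _ fB).
by rewrite prodr_const ler_wiXn2l //; [case/andP: p1 | case/andP: p1 | lia].
Qed.

End TwoRounds.

(** * Combining the rounds and numerical bounds *)

Section Estimates.
Local Open Scope ring_scope.
Variable R : realType.

Lemma gnp_prob_le (n : nat) (p : R) (A B : pred (rel 'I_n)) :
  0 <= p <= 1 -> (forall G, A G -> B G) -> gnp_prob p A <= gnp_prob p B.
Proof.
move=> p01 AB; rewrite !gnp_probE [leLHS]big_mkcond [leRHS]big_mkcond /=.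
have w0 E := weight_ge0 E (fun f => pair_prob01 (n := n) f p01).
by apply: ler_sum => E _; case: ifP => [/AB-> //|_]; case: ifP.
Qed.

Lemma gnp_prob_le1 (n : nat) (p : R) (A : pred (rel 'I_n)) :
  0 <= p <= 1 -> gnp_prob p A <= 1.
Proof.
move=> p01; rewrite -(sum_weight (pair_prob (n := n) p)).
apply: le_trans (gnp_prob_le (B := xpredT) p01 _) _ => //.
by rewrite gnp_probE.
Qed.

(** Condition on the first round [E]. If it is not [joined], the trivial bound 0 is used; otherwise
    the second round fails with probability at most [tau], which does not depend on [E]. Averaging
    over [E] adds the two failure terms. *)
Lemma gnp_chi_lin_lower (n m : nat) (p q w : R) :
  (0 < m)%N -> 0 <= p <= 1 -> 0 <= q <= 1 -> 1 <= w ->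
  1 - (4 ^+ n * (1 - p) ^+ (m * m) +
       2 ^+ n * (w ^+ (9 * m + 2) * (1 + q / w) ^+ (n ^ 2) * (1 - q) ^+ (m * m %/ 4)))
  <= gnp_prob (p + q - p * q) (fun G : rel 'I_n => (n < chi_lin G + 9 * m)%N).
Proof.
move=> m0 p01 q01 w1; rewrite gnp_prob_union.
have p0 E := weight_ge0 E (fun f => pair_prob01 (n := n) f p01).
have q0 E := weight_ge0 E (fun f => pair_prob01 (n := n) f q01).
pose A E := \sum_(H | (n < chi_lin (Defs.adjacent (E :|: H)) + 9 * m)%N)
  weight (pair_prob (n := n) q) H.
set tau := 2 ^+ n * _.
have tau0 : 0 <= tau.
  by apply: le_trans (prob_trap m (9 * m + 2) finset.set0 q01 w1); apply: sumr_ge0.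
have key E : 1 - ((~~ `[< joined (Defs.adjacent E) m >])%:R + tau) <= A E.
  case: asboolP => [jn|_] /=; last first.
    by apply: le_trans (_ : 0 <= _); [lra | apply: sumr_ge0].
  rewrite add0r lerBlDr -(sum_weight (pair_prob (n := n) q)).
  rewrite [leLHS](bigID (fun H => (n < chi_lin (Defs.adjacent (E :|: H)) + 9 * m)%N)) /=.
  rewrite lerD2l; apply: le_trans (prob_trap m (9 * m + 2) E q01 w1).
  rewrite [leLHS]big_mkcond [leRHS]big_mkcond /=; apply: ler_sum => H _.
  case: ifPn => [short|_]; last by case: ifP.
  case: ifPn => // /existsPn nt; case/negP: short.
  have := @chi_lin_gt 'I_n m E H m0 jn (fun S Gam => nt (S, Gam)).
  by rewrite card_ord.
apply: le_trans (_ : \sum_E weight (pair_prob p) E *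
    (1 - ((~~ `[< joined (Defs.adjacent E) m >])%:R + tau)) <= _); last first.
  by apply: ler_sum => E _; rewrite ler_wpM2l.
under eq_bigr do rewrite mulrBr mulr1 mulrDr.
rewrite sumrB big_split -mulr_suml /= sum_weight mul1r lerD2l lerN2 lerD2r.
apply: le_trans (prob_not_joined n m p01).
rewrite [leRHS]big_mkcond /=; apply: ler_sum => E _.
by case: ifP; rewrite (mulr1, mulr0).
Qed.

Lemma one_sub_exp_le (t : R) k : 0 <= t <= 1 -> (1 - t) ^+ k <= expR (- (t * k%:R)).
Proof.
move=> /andP[t0 t1]; rewrite -mulNr mulrC expRM_natl lerXn2r ?nnegrE ?expR_ge0 ?subr_ge0 //.
exact: expR_ge1Dx.
Qed.

Lemma two_le_expR1 : 2 <= expR 1 :> R.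
Proof. by have := expR_ge1Dx (1 : R); lra. Qed.

(** For such x one has x^2 <= (x / 45)^3, and x / 45 <= exp (x / 45). *)
Lemma sqr_le_expR (x : R) : 45 ^+ 3 <= x -> x ^+ 2 <= expR (x / 15).
Proof.
move=> x45; have x0 : 0 < x by apply: lt_le_trans x45; rewrite exprn_gt0.
have -> : x / 15 = 3%:R * (x / 45) by lra.
rewrite expRM_natl; apply: le_trans (_ : (x / 45) ^+ 3 <= _).
  rewrite expr_div_n ler_pdivlMr ?exprn_gt0 // [in leRHS]exprSr.
  by rewrite ler_wpM2l // exprn_ge0 ?ltW.
rewrite lerXn2r ?nnegrE ?expR_ge0 ?divr_ge0 ?(ltW x0) //.
by apply: le_trans (expR_ge1Dx _); rewrite lerDr.
Qed.

Lemma gnp_chi_lin_tail (n : nat) (om : R) :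
  45 ^+ 6 <= om -> om <= n%:R ->
  1 - 2 * expR (- n%:R) <= gnp_prob (om / n%:R)
    (fun G : rel 'I_n => n%:R - 510 * n%:R / Num.sqrt om <= (chi_lin G)%:R) <= 1.
Proof.
move=> om45 omn; set N : R := n%:R; set x := Num.sqrt om.
have om0 : 0 < om by apply: lt_le_trans om45; rewrite exprn_gt0.
have omx : om = x ^+ 2 by rewrite sqr_sqrtr ?ltW.
have x45 : 45 ^+ 3 <= x.
  by rewrite -(@ler_pXn2r _ 2) ?nnegrE ?exprn_ge0 ?sqrtr_ge0 // -exprM -omx.
have x1 : 1 <= x by apply: le_trans x45; rewrite exprn_ege1 //; lra.
have x0 : 0 < x by lra.
have N0 : 0 < N by rewrite /N; lra.
have N1 : 1 <= N by rewrite /N; apply: le_trans omn; rewrite omx exprn_ege1.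
set P : R := om / N.
have P01 : 0 <= P <= 1 by rewrite /P divr_ge0 ?ler_pdivrMr ?(ltW N0) ?(ltW om0) //= mul1r.
pose y : R := N / x.
have xy : x * y = N by rewrite /y mulrCA divff ?mulr1 ?gt_eqF.
have yx : x <= y by rewrite /y ler_pdivlMr // -expr2 -omx.
have Py : P * y ^+ 2 = N.
  have y0 : y != 0 by rewrite gt_eqF //; lra.
  by rewrite /P omx -xy; field; rewrite y0 gt_eqF.
(* With y = n / sqrt om, this [m] is at least 9y, so p m^2 >= (81 / 2) n outweighs the union bounds,
   while 9m <= 90y stays within the allowed 510y. *)
pose m := Num.truncn (10 * y).
have /andP[mle mgt] : (m%:R <= 10 * y < m.+1%:R) by apply: truncn_itv; lra.
rewrite -natr1 in mgt.
have PN : N * P = om by rewrite /P mulrCA divff ?mulr1 ?gt_eqF.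
have yE : 510 * N / x = 510 * y by rewrite /y mulrA.
clearbody m P y.
have m9 : 9 * y <= m%:R :> R by lra.
have m0 : (0 < m)%N by rewrite -(ltr0n R); lra.
(* The second round has the probability q with (1 - p) (1 - q) = 1 - P. *)
pose p : R := P / 2; pose q : R := P / (2 - P).
have p01 : 0 <= p <= 1 by rewrite /p; lra.
have q01 : 0 <= q <= 1.
  have P2 : 0 < 2 - P by lra.
  by rewrite /q ler_pdivrMr // mul1r divr_ge0 ?(ltW P2) //=; lra.
have PP : 0 <= P * (1 - P) by rewrite mulr_ge0 //; lra.
have PP2 : 0 <= P * P by rewrite mulr_ge0 //; lra.
have qP : q <= P by rewrite /q ler_pdivrMr; lra.
have pq : p <= q by rewrite /p /q ler_pdivlMr; lra.
have PE : P = (p + q - p * q) by rewrite /p /q; field; lra.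
have om1 : 1 <= om by rewrite omx exprn_ege1.
have pm : 81 / 2 * N <= p * m%:R ^+ 2.
  apply: le_trans (_ : (p * (9 * y) ^+ 2 <= _)).
    by rewrite exprMn /p; lra.
  by rewrite ler_wpM2l ?lerXn2r ?nnegrE //; lra.
have t1 : 4 ^+ n * (1 - p) ^+ (m * m) <= expR (- N).
  apply: le_trans (_ : (expR (2 * N) * expR (- (p * (m * m)%:R)) <= _)).
    rewrite ler_pM ?exprn_ge0 ?one_sub_exp_le //; first by lra.
    rewrite mulrC expRM_natl lerXn2r ?nnegrE ?expR_ge0 //.
    have -> : (2 = 1 + 1 :> R) by lra.
    by rewrite expRD; have := two_le_expR1; nra.
  by rewrite -expRD ler_expR natrM -expr2; lra.
(* Taking w = om, the four exponents are at most N, (92 / 15) N, N and 1 - (81 / 8) N; their sum is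
   below -N for N this large. The second uses om = x^2 <= exp (x / 15) and 9m + 2 <= 92y, the third
   n P = om, and the 1 in the last pays for rounding m^2 / 4 down. *)
have t2 : (2 ^+ n * (om ^+ (9 * m + 2) * (1 + q / om) ^+ (n ^ 2) *
    (1 - q) ^+ (m * m %/ 4)) <= expR (- N)).
  have b1 : 2 ^+ n <= expR N.
    by rewrite /N -[n%:R]mulr1 expRM_natl lerXn2r ?nnegrE ?expR_ge0 ?two_le_expR1.
  have b2 : om ^+ (9 * m + 2) <= expR ((92 / 15) * N).
    apply: le_trans (_ : (expR (x / 15) ^+ (9 * m + 2) <= _)).
      by rewrite lerXn2r ?nnegrE ?expR_ge0 ?(ltW om0) // omx sqr_le_expR.
    by rewrite -expRM_natl ler_expR natrD natrM -xy; nra.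
  have b3 : (1 + q / om) ^+ (n ^ 2) <= expR N.
    have qo : 0 <= q / om by rewrite divr_ge0 ?(ltW om0) //; lra.
    apply: le_trans (_ : (expR (q / om) ^+ (n ^ 2) <= _)).
      by rewrite lerXn2r ?nnegrE ?expR_ge0 ?expR_ge1Dx //; lra.
    rewrite -expRM_natl ler_expR natrX -/N mulrA ler_pdivrMr //.
    apply: le_trans (_ : (N ^+ 2 * P <= _)).
      by rewrite ler_wpM2l // exprn_ge0 // ltW.
    by rewrite expr2 -mulrA PN.
  have b4 : (1 - q) ^+ (m * m %/ 4) <= expR (1 - 81 / 8 * N).
    apply: le_trans (one_sub_exp_le _ q01) _; rewrite ler_expR.
    have c4 : m%:R ^+ 2 / 4 - 1 <= (m * m %/ 4)%:R :> R.
      have : (m * m <= (m * m %/ 4).+1 * 4)%N by rewrite ltnW // ltn_ceil.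
      by rewrite -(ler_nat R) !natrM -natr1 -expr2; lra.
    have c5 : q * (m%:R ^+ 2 / 4 - 1) <= q * (m * m %/ 4)%:R.
      by rewrite ler_wpM2l //; lra.
    have c6 : p * m%:R ^+ 2 <= q * m%:R ^+ 2 by rewrite ler_wpM2r ?exprn_ge0.
    by lra.
  apply: le_trans (_ : (expR N * (expR ((92 / 15) * N) * expR N * expR (1 - 81 / 8 * N)) <= _)).
    have o1 : 0 <= 1 + q / om by rewrite addr_ge0 // divr_ge0 ?(ltW om0) //; lra.
    have q1 : 0 <= 1 - q by lra.
    by rewrite !ler_pM ?mulr_ge0 ?exprn_ge0 ?(ltW om0).
  by rewrite -!expRD ler_expR; lra.
apply/andP; split; last exact: gnp_prob_le1.
apply: le_trans (_ : (_ <= gnp_prob P (fun G : rel 'I_n => (n < chi_lin G + 9 * m)%N))) _.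
  rewrite PE; apply: le_trans (gnp_chi_lin_lower n m0 p01 q01 om1).
  by lra.
apply: gnp_prob_le => // G; rewrite -(ltr_nat R) natrD natrM -/N => lt.
rewrite yE; lra.
Qed.

End Estimates.

(** * Passage to the limit *)

Local Open Scope classical_set_scope.
Local Open Scope ring_scope.

Theorem theorem1p2 (R : realType) (omega : nat -> R)
  (omega_le : forall n : nat, omega n <= n%:R)
  (omega_oo : omega n @[n --> \oo] --> +oo) :
  gnp_prob (omega n / n%:R)
    (fun G : rel 'I_n =>
       n%:R - 510 * n%:R / Num.sqrt (omega n) <= (chi_lin G)%:R)
    @[n --> \oo] --> (1 : R).
Proof.
have lim1 : (1 - 2 * harmonic n : R) @[n --> \oo] --> (1 : R).
  rewrite -[X in _ --> X](_ : 1 - 2 * 0 = 1 :> R); last by rewrite mulr0 subr0.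
  by apply: cvgB; [exact: cvg_cst | apply: cvgM; [exact: cvg_cst | exact: cvg_harmonic]].
apply: squeeze_cvgr lim1 (cvg_cst (1 : R)).
near=> n.
have om45 : 45 ^+ 6 <= omega n by near: n; apply: (cvgryPge _).1 omega_oo _.
have /andP[lo ->] := gnp_chi_lin_tail om45 (omega_le n); rewrite andbT.
(* [harmonic n] is 1 / (n + 1), which dominates exp (-n) because exp n >= 1 + n. *)
apply: le_trans lo; rewrite lerD2l lerN2 ler_wpM2l // expRN.
rewrite lef_pV2 ?posrE ?expR_gt0 ?ltr0n //.
by rewrite -natr1 addrC expR_ge1Dx.
Unshelve. all: by end_near.
Qed.
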